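(* Let $G_D$ be the dodecahedron graph, i.e. the graph formed by the $20$ vertices and $30$ edges of the regular dodecahedron. Then the (divisorial) gonality of $G_D$ satisfies $\operatorname{gon}(G_D)=6$.
   Context: Graphs are finite, connected and undirected, without loops. Explicitly, the dodecahedron graph is the graph with vertices $a_i,b_i$ ($i\in\mathbb{Z}/10$) and edges $a_ia_{i+1}$, $a_ib_i$, $b_ib_{i+2}$ for all $i\in\mathbb{Z}/10$ (a $3$-regular simple graph). A divisor on a graph $G$ is a function $D:V(G)\to\mathbb{Z}$ (an assignment of an integer number of chips to each vertex); its degree is $\deg(D)=\sum_v D(v)$, and it is debt-free if $D(v)\ge 0$ for all $v$. Firing a vertex $v$ changes $D$ by moving one chip from $v$ to the other endpoint along each edge incident to $v$ (so $v$ loses $\operatorname{val}(v)$ chips, where $\operatorname{val}(v)$ is the number of edges incident to $v$). Two divisors are equivalent if one can be obtained from the other by a finite sequence of chip-firing moves (debt is allowed at intermediate stages). The gonality $\operatorname{gon}(G)$ is the minimum integer $N$ such that there exists a divisor $D$ of degree $N$ on $G$ with the property that for every vertex $q\in V(G)$, the divisor obtained from $D$ by removing one chip from $q$ is equivalent to a debt-free divisor. *)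

(* Defs.v *)
From mathcomp Require Import all_boot all_order all_algebra.

Set Implicit Arguments.
Unset Strict Implicit.
Unset Printing Implicit Defensive.

Import Order.TTheory GRing.Theory Num.Theory.
Local Open Scope ring_scope.

(* Finite connected undirected loopless graphs; parallel edges are allowed, *)
(* [mult u v] being the number of edges between [u] and [v].                *)
Record graph := Graph {
  vertex :> finType;
  mult : vertex -> vertex -> nat;
  mult_sym : forall u v, mult u v = mult v u;
  mult_loopless : forall v, mult v v = 0%N;
  graph_connected :
    forall u v, connect [rel x y : vertex | (0 < mult x y)%N] u v
}.

Definition divisor (G : graph) := {ffun G -> int}.

Section Divisors.
Variable G : graph.
Implicit Types (D E : divisor G) (q v : G).

Definition degree D : int := \sum_v D v.

Definition debt_free D : Prop := forall v, 0 <= D v.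

Definition valency v : nat := (\sum_u mult v u)%N.

Definition fire D v : divisor G :=
  [ffun u => if u == v then D u - (valency v)%:Z else D u + (mult v u)%:Z].

(* As the graph is undirected, firing every vertex once is the identity;     *)
(* hence this relation is symmetric.                                         *)
Definition equivalent D E : Prop := exists s : seq G, E = foldl fire D s.

Definition remove_chip D q : divisor G :=
  [ffun v => if v == q then D v - 1 else D v].

Definition positive_rank D : Prop :=
  forall q, exists E, equivalent (remove_chip D q) E /\ debt_free E.

End Divisors.

Definition is_gonality (G : graph) (N : int) : Prop :=
  (exists D : divisor G, degree D = N /\ positive_rank D) /\
  (forall M : int,
     (exists D : divisor G, degree D = M /\ positive_rank D) -> N <= M).

(* [inl i] is the vertex a_i and [inr i] is the vertex b_i. *)
Definition dodecahedron_adj (u v : 'Z_10 + 'Z_10) : bool :=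
  match u, v with
  | inl i, inl j => (j == i + 1) || (i == j + 1)
  | inl i, inr j => i == j
  | inr i, inl j => i == j
  | inr i, inr j => (j == i + 2) || (i == j + 2)
  end.

Lemma dodecahedron_sym u v :
  nat_of_bool (dodecahedron_adj u v) = dodecahedron_adj v u.
Proof. by case: u v => i [] j //=; rewrite 1?orbC // eq_sym. Qed.

Lemma dodecahedron_loopless v : nat_of_bool (dodecahedron_adj v v) = 0%N.
Proof. by case: v => [] [[|[|[|[|[|[|[|[|[|[|i]]]]]]]]]]]. Qed.

Lemma dodecahedron_connected u v :
  connect [rel x y | (0 < nat_of_bool (dodecahedron_adj x y))%N] u v.
Proof.
set e := [rel x y | _].
have sym_e : connect_sym e.
  by apply: sym_connect_sym => x y /=; rewrite dodecahedron_sym.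
have conn_a (n : nat) : connect e (inl 0) (inl n%:R).
  elim: n => [|n IHn]; first exact: connect0.
  apply: connect_trans IHn (connect1 _) => /=.
  by rewrite -natr1 eqxx.
have conn w : connect e (inl 0) w.
  case: w => i; last apply: (@connect_trans _ _ (inl i)).
  - by rewrite -(natr_Zp i).
  - by rewrite -(natr_Zp i).
  - by apply: connect1; rewrite /= eqxx.
by apply: (connect_trans _ (conn v)); rewrite sym_e.
Qed.

Definition dodecahedron : graph :=
  Graph dodecahedron_sym dodecahedron_loopless dodecahedron_connected.

(* Main.v *)
Require Import Defs.
From mathcomp Require Import all_boot all_order all_algebra.
From mathcomp Require Import zify.

(** For the lower bound, play with eggs: connected vertex sets, at least one of
    which avoids any given set of fewer than [k] vertices, and no two of which
    can be separated by fewer than [k] edges.  Let [D] be debt-free, of positive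
    rank and of degree less than [k].  Some egg [A] carries no chip; move chips
    onto [A] along a firing script [f], one level set of [f] at a time, and stop
    at the first level [c] where [A] is reached.  Then [A] lies in [f <= c],
    while an egg that lost all its chips on the way lies in [f > c].  The set
    firing crosses every edge between the two parts, so the latter egg would be
    separated from [A] by at most [degree D] edges.  Hence more and more eggs
    carry chips, which cannot go on forever.  On the dodecahedron the eggs are
    the connected sets of at least 6 vertices, and [k = 6].

    For the upper bound, the spheres around a vertex have 1, 3, 6, 6, 3, 1
    elements, and 6 chips can travel from a vertex to its antipode by firing
    balls, visiting every sphere on the way. *)

Set Implicit Arguments.
Unset Strict Implicit.
Unset Printing Implicit Defensive.

Import Order.TTheory GRing.Theory Num.Theory.
Local Open Scope ring_scope.

(** * Firing scripts and scripts stopped at a level *)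

Section ChipFiring.
Variable G : graph.
Implicit Types (D E : divisor G) (f g : G -> int) (u v q : G).

(** Minus the graph Laplacian: the net number of chips [v] receives when every [u] fires [f u]
    times. *)
Definition spread f v : int := \sum_u (f u - f v) *+ mult u v.

Lemma eq_spread f g : f =1 g -> spread f =1 spread g.
Proof. by move=> fg v; apply: eq_bigr => u _; rewrite !fg. Qed.

Lemma spreadD f g v : spread (fun u => f u + g u) v = spread f v + spread g v.
Proof.
rewrite /spread -big_split /=; apply: eq_bigr => u _.
by rewrite -mulrnDl opprD addrACA.
Qed.

Lemma spread_shift f c v : spread (fun u => f u + c) v = spread f v.
Proof. by apply: eq_bigr => u _; rewrite opprD addrACA subrr addr0. Qed.

Lemma spread_cst c v : spread (fun=> c) v = 0.
Proof. by rewrite /spread big1 // => u _; rewrite subrr mul0rn. Qed.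

Lemma sum_spread f : \sum_v spread f v = 0.
Proof.
have eq_opp : \sum_v spread f v = - \sum_v spread f v.
  rewrite [LHS]exchange_big -sumrN; apply: eq_bigr => v _ /=.
  rewrite /spread -sumrN; apply: eq_bigr => u _.
  by rewrite -mulNrn opprB mult_sym.
by move: eq_opp; move: (\sum_v _) => x ?; lia.
Qed.

Lemma fireE D w v : fire D w v = D v + spread (fun u => (u == w)%:Z) v.
Proof.
rewrite ffunE /spread; case: eqP => [->|/eqP nvw]; congr (_ + _).
  rewrite /valency (big_morph Posz PoszD (erefl _)) -sumrN; apply: eq_bigr => u _ /=.
  rewrite mult_sym; case: eqP => [->|_]; first by rewrite mult_loopless.
  by rewrite sub0r mulNrn natz.
rewrite (bigD1 w) //= eqxx subr0 big1 ?addr0 ?natz // => u.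
by move=> /negbTE ->; rewrite subrr mul0rn.
Qed.

Lemma spread_le f g v :
  f v = g v -> (forall u, f u <= g u) -> spread f v <= spread g v.
Proof.
by move=> fgv fg; apply: ler_sum => u _; rewrite fgv lerMn2r lerD2r fg orbT.
Qed.

Lemma spread_lt f g u v :
    f v = g v -> (forall w, f w <= g w) -> f u < g u -> (0 < mult u v)%N ->
  spread f v < spread g v.
Proof.
move=> fgv fg fgu uv; rewrite /spread !(bigD1 (P := predT) u) //= ltr_leD //.
  by rewrite fgv ltrMn2r uv ltrD2r.
by apply: ler_sum => w _; rewrite fgv lerMn2r lerD2r fg orbT.
Qed.

Definition fire_script D f : divisor G := [ffun v => D v + spread f v].

Lemma fire_scriptD D f g :
  fire_script (fire_script D f) g = fire_script D (fun u => f u + g u).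
Proof. by apply/ffunP => v; rewrite !ffunE spreadD addrA. Qed.

Lemma fire_script_cst D f c : f =1 (fun=> c) -> fire_script D f = D.
Proof.
by move=> fc; apply/ffunP => v; rewrite ffunE (eq_spread fc) spread_cst addr0.
Qed.

Lemma foldl_fire D s :
  foldl (@fire G) D s = fire_script D (fun u => (count_mem u s)%:Z).
Proof.
elim: s D => [|w s IHs] D /=; first by rewrite (@fire_script_cst _ _ 0).
rewrite IHs; apply/ffunP => v; rewrite [LHS]ffunE fireE [RHS]ffunE -addrA.
congr (_ + _); rewrite -spreadD; apply: eq_spread => u.
by rewrite PoszD eq_sym.
Qed.

Lemma bounded_script f : exists M : int, forall u, `|f u| <= M.
Proof.
by exists (\sum_u `|f u|) => u; rewrite (bigD1 u) //= lerDl sumr_ge0.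
Qed.

(** Adding a constant to a script changes nothing, so an integer script can be made nonnegative and
    then read as a list of firings. *)
Lemma equivalentP D E : equivalent D E <-> exists f, E = fire_script D f.
Proof.
split=> [[s ->]|[f ->]]; first by rewrite foldl_fire; eexists.
have [M fM] := bounded_script f; pose n u := absz (f u + M).
have fM_ge0 u : 0 <= f u + M by have := fM u; lia.
exists (flatten [seq nseq (n u) u | u <- enum G]).
rewrite foldl_fire; apply/ffunP => v; rewrite !ffunE; congr (_ + _).
rewrite -(spread_shift f M v); apply: eq_spread => u.
rewrite count_flatten -!map_comp sumnE big_map -[LHS]gez0_abs //.
congr Posz; rewrite -enumT big_enum (bigD1 u) //= count_nseq /= eqxx mul1n big1.
  by rewrite addn0.
by move=> w /negbTE nwu; rewrite count_nseq /= nwu.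
Qed.

Lemma equivalent_trans D1 D2 D3 :
  equivalent D1 D2 -> equivalent D2 D3 -> equivalent D1 D3.
Proof. by move=> [s ->] [t ->]; exists (s ++ t); rewrite foldl_cat. Qed.

Lemma equivalent_sym D E : equivalent D E -> equivalent E D.
Proof.
move=> /equivalentP[f ->]; apply/equivalentP; exists (fun u => - f u).
by rewrite fire_scriptD (@fire_script_cst _ _ 0) // => u; rewrite subrr.
Qed.

Lemma equivalent_remove_chip D E q :
  equivalent D E -> equivalent (remove_chip D q) (remove_chip E q).
Proof.
move=> /equivalentP[f ->]; apply/equivalentP; exists f.
by apply/ffunP => v; rewrite !ffunE; case: eqP => _; rewrite // addrAC.
Qed.

Lemma degree_equivalent D E : equivalent D E -> degree E = degree D.
Proof.
move=> /equivalentP[f ->]; rewrite /degree.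
under eq_bigr do rewrite ffunE.
by rewrite big_split /= sum_spread addr0.
Qed.

(** The effect of a script does not depend on the divisor, so the chip taken from [q] can be put
    back after firing. *)
Lemma positive_rankE D :
  positive_rank D <->
  forall q, exists E, [/\ equivalent D E, debt_free E & 0 < E q].
Proof.
pose add_chip E q : divisor G := [ffun v => E v + (v == q)%:Z].
have add_chipK E q : remove_chip (add_chip E q) q = E.
  by apply/ffunP => v; rewrite !ffunE; case: eqP => _; rewrite ?addrK ?addr0.
have remove_chipK E q : add_chip (remove_chip E q) q = E.
  by apply/ffunP => v; rewrite !ffunE; case: eqP => _; rewrite ?subrK ?addr0.
split=> [rkD q | rkD q].
  have [E [/equivalentP[f defE] E_ge0]] := rkD q.
  exists (add_chip E q); split.
  - apply/equivalentP; exists f; rewrite -(remove_chipK D q) defE.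
    by apply/ffunP => v; rewrite !ffunE addrAC.
  - by move=> v; rewrite ffunE addr_ge0.
  - by rewrite ffunE eqxx ltr_wpDl.
have [E [DE E_ge0 Eq_gt0]] := rkD q.
exists (remove_chip E q); split; first exact: equivalent_remove_chip.
by move=> v; rewrite ffunE; case: eqP => [->|_] //; rewrite subr_ge0.
Qed.

(* Stops the script [f] at level [c]: lowering [c] by one fires the set      *)
(* [f > c], so that the divisors [truncate D f c] interpolate between [D]    *)
(* and [fire_script D f] by set-firing moves.                                *)
Definition truncate D f c := fire_script D (fun u => Num.max (f u) c).

Lemma equivalent_truncate D f c : equivalent D (truncate D f c).
Proof. by apply/equivalentP; eexists. Qed.

Lemma truncate_ge D f c v : f v <= c -> D v <= truncate D f c v.
Proof.
move=> fv; rewrite ffunE lerDl -(spread_cst c v).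
by apply: spread_le => [|u]; [rewrite max_r | rewrite le_max lexx orbT].
Qed.

Lemma truncate_gt D f c u v :
  f v <= c -> c < f u -> (0 < mult u v)%N -> D v < truncate D f c v.
Proof.
move=> fv fu uv; rewrite ffunE ltrDl -(spread_cst c v).
apply: (spread_lt (u := u)) => // [|w|].
- by rewrite max_r.
- by rewrite le_max lexx orbT.
- by rewrite lt_max fu.
Qed.

(** A vertex with [f v <= c] has only gained chips since [D]; any other has at least as many as at
    the end of the script. *)
Lemma truncate_debt_free D f c :
  debt_free D -> debt_free (fire_script D f) -> debt_free (truncate D f c).
Proof.
move=> D_ge0 E_ge0 v; have [fv|/ltW fv] := leP (f v) c.
  exact: le_trans (D_ge0 v) (truncate_ge D fv).
apply: le_trans (E_ge0 v) _; rewrite !ffunE lerD2l.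
by apply: spread_le => [|u]; [rewrite max_l | rewrite le_max lexx].
Qed.

Lemma truncate_le D f c c' v :
  c <= c' -> c' <= f v -> truncate D f c v <= truncate D f c' v.
Proof.
move=> cc' fv; rewrite !ffunE lerD2l.
by apply: spread_le => [|w]; lia.
Qed.

Lemma truncate_lt D f c c' u v :
    c < c' -> c' <= f v -> f u < c' -> (0 < mult u v)%N ->
  truncate D f c v < truncate D f c' v.
Proof.
move=> cc' fv fu uv; rewrite !ffunE ltrD2l.
by apply: (spread_lt (u := u)) => // [|w|]; lia.
Qed.

(** * Cuts and connected sets *)

Definition cut (U : {set G}) : nat :=
  (\sum_(u in U) \sum_(v in ~: U) mult u v)%N.

(** Across each edge leaving [U] the stopped script drops by at least one, so the edge delivers a
    chip to its outer end, where [D] was already nonnegative. *)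
Lemma cut_le_degree D f c :
    debt_free D -> debt_free (truncate D f c) ->
  (cut [set u | c < f u])%:Z <= degree D.
Proof.
move=> D_ge0 T_ge0; set U := [set u | _].
rewrite -(degree_equivalent (equivalent_truncate D f c)) /degree.
rewrite (bigID [in ~: U]) /= ler_wpDr ?sumr_ge0 //.
rewrite /cut exchange_big /= (big_morph Posz PoszD (erefl _)).
apply: ler_sum => v; rewrite !inE -leNgt => fv.
rewrite ffunE -[leLHS]add0r lerD //.
apply: le_trans (_ : spread (fun u => (u \in U)%:Z + c) v <= _).
  rewrite spread_shift /spread (big_morph Posz PoszD (erefl _)) big_mkcond /=.
  apply: ler_sum => u _; rewrite !inE (ltNge c (f v)) fv /= subr0.
  by case: ifP => _; rewrite ?mul0rn // -[leLHS]natz lexx.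
by apply: spread_le => [|u]; rewrite inE; case: ltP => ?; lia.
Qed.

Definition connected_set (A : {set G}) : bool :=
  [forall u in A, forall v in A,
     connect [rel x y | [&& x \in A, y \in A & (0 < mult x y)%N]] u v].

Lemma connected_crossing (A U : {set G}) u v :
    connected_set A -> u \in A -> v \in A -> u \in U -> v \notin U ->
  exists x y, [/\ x \in A, y \in A, x \in U, y \notin U & (0 < mult x y)%N].
Proof.
move=> /forall_inP conA uA vA uU vU.
have /forall_inP/(_ v vA)/connectP[p] := conA u uA.
elim: p u uA uU => [|w p IHp] u uA uU /=; first by move=> _ ev; rewrite ev uU in vU.
move=> /andP[/and3P[_ wA uw] path_p] ev.
have [wU|wU] := boolP (w \in U); first exact: (IHp w).
by exists u, w.
Qed.

(** * The egg-cut lower bound *)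

Section EggCut.
Variables (F : {set {set G}}) (k : nat).
Hypothesis F_connected : forall A, A \in F -> connected_set A.
Hypothesis F_nonempty : forall A, A \in F -> A != set0.
Hypothesis F_hitting :
  forall S : {set G}, (#|S| < k)%N -> exists2 A, A \in F & [disjoint A & S].
Hypothesis F_cut : forall (U A B : {set G}),
  A \in F -> B \in F -> A \subset U -> B \subset ~: U -> (k <= cut U)%N.

Let hit D := [set A in F | [exists v in A, 0 < D v]].

Lemma card_support_le_degree D :
  debt_free D -> (#|[set v | 0 < D v]|)%:Z <= degree D.
Proof.
move=> D_ge0; rewrite -sum1_card (big_morph Posz PoszD (erefl _)) big_mkcond /=.
apply: ler_sum => v _; rewrite inE.
by have := D_ge0 v; case: ifP => ?; lia.
Qed.

Lemma hit_more D :
    debt_free D -> positive_rank D -> degree D < k ->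
  exists D', [/\ equivalent D D', debt_free D' & (#|hit D| < #|hit D'|)%N].
Proof.
move=> D_ge0 /positive_rankE rkD degD.
have [|A FA disjA] := F_hitting (S := [set v | 0 < D v]).
  by have := card_support_le_degree D_ge0; lia.
have A0 v : v \in A -> D v = 0.
  move=> vA; have := disjointFr disjA vA; rewrite inE.
  by have := D_ge0 v; lia.
have [q qA] := set0Pn _ (F_nonempty FA).
have [E [/equivalentP[f ->] E_ge0 Eq_gt0]] := rkD q.
(* Levels run down from [M], where nothing has fired, to [-M], where the whole script has. *)
have [M fM] := bounded_script f; pose T m := truncate D f (M - m%:Z).
have T_ge0 m : debt_free (T m) by exact: truncate_debt_free.
have T0 : T 0%N = D.
  by apply: (@fire_script_cst _ _ M) => u; have := fM u; lia.
pose P m := [exists v in A, 0 < T m v].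
have exP : exists m, P m.
  exists (absz (M + M)); apply/exists_inP; exists q => //.
  move: Eq_gt0; rewrite !ffunE (@eq_spread (fun u => Num.max _ _) f) // => u.
  by have := fM u; lia.
case: (ex_minnP exP) => [[|m] Pm min_m].
  by case/exists_inP: Pm => v vA; rewrite T0 A0.
(* Passing from [T m] to [T m.+1] fires exactly the set [f > c]. *)
pose c := M - m.+1%:Z.
have T1E : truncate D f c = T m.+1 by [].
have TmE : truncate D f (c + 1) = T m.
  by congr truncate; rewrite /c -addn1 PoszD opprD addrA addrNK.
clearbody c.
have Tm0 v : v \in A -> T m v = 0.
  move=> vA; apply/eqP; rewrite eq_le T_ge0 andbT leNgt; apply/negP => Tv.
  have /min_m : P m by apply/exists_inP; exists v.
  by rewrite ltnn.
exists (T m.+1); split; [exact: equivalent_truncate | exact: T_ge0 |].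
have A_hit : A \in hit (T m.+1) by rewrite inE FA.
have A_unhit : A \notin hit D.
  rewrite inE FA /=; apply/exists_inP => -[v vA]; rewrite A0 //.
have [sub|/subsetPn[B]] := boolP (hit D \subset hit (T m.+1)).
  by apply: proper_card; apply/properP; split=> //; exists A.
rewrite inE => /andP[FB /exists_inP[w wB Dw]].
rewrite inE FB /= => /exists_inPn B_unhit; exfalso.
pose U := [set u | c < f u].
have B0 v : v \in B -> T m.+1 v = 0.
  by move=> /B_unhit; have := T_ge0 m.+1 v; lia.
have wU : w \in U.
  rewrite inE ltNge; apply/negP => /(truncate_ge D).
  by rewrite T1E B0 // leNgt Dw.
(* An edge of [B] leaving [U] would have brought a chip to its outer end, but [B] has none left. *)
have BU : B \subset U.
  apply/subsetP => v vB; apply/negPn/negP => vU.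
  have [x [y [xB yB]]] := connected_crossing (F_connected FB) wB vB wU vU.
  rewrite !inE -leNgt => xU yU xy.
  have := truncate_gt D yU xU xy; rewrite T1E B0 //.
  by rewrite ltNge D_ge0.
(* Firing [U] adds no chip inside [U], so the first chip on [A] lands outside; an edge of [A]
   leaving [U] would put its chipless inner end into debt. *)
have AU : A \subset ~: U.
  have [a aA Ta] := exists_inP Pm.
  have aU : a \notin U.
    rewrite inE; apply/negP => fa.
    suff : T m.+1 a <= 0 by rewrite leNgt Ta.
    by rewrite -(Tm0 a aA) -T1E -TmE; apply: truncate_le; rewrite ?lerDl ?lezD1.
  apply/subsetP => v vA; rewrite inE; apply/negP => vU.
  have [x [y [xA yA xU]]] := connected_crossing (F_connected FA) vA aA vU aU.
  move: xU; rewrite !inE -leNgt => xU yU xy.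
  suff : T m.+1 x < 0 by rewrite ltNge T_ge0.
  rewrite -(Tm0 x xA) -T1E -TmE; apply: (@truncate_lt _ _ _ _ y).
  - by rewrite ltrDl.
  - by rewrite lezD1.
  - by rewrite ltzD1.
  - by rewrite mult_sym.
have := @cut_le_degree D f c D_ge0; rewrite T1E => /(_ (T_ge0 m.+1)).
by rewrite leNgt (lt_le_trans degD) // lez_nat (F_cut FB FA).
Qed.

Lemma egg_cut_bound D : (0 < k)%N -> positive_rank D -> k%:Z <= degree D.
Proof.
move=> k_gt0 rkD; rewrite leNgt; apply/negP => degD.
have [|A FA _] := F_hitting (S := set0); first by rewrite cards0.
have [q _] := set0Pn _ (F_nonempty FA).
have [E [DE E_ge0 _]] := (positive_rankE D).1 rkD q.
have no_bound n : exists D', [/\ equivalent D D', debt_free D' & (n <= #|hit D'|)%N].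
  elim: n => [|n [D1 [DD1 D1_ge0 hitD1]]]; first by exists E.
  have [||D2 [D12 D2_ge0 hitD2]] := hit_more D1_ge0.
  - apply/positive_rankE => p; have [E' [DE' ? ?]] := (positive_rankE D).1 rkD p.
    by exists E'; split=> //; apply: equivalent_trans (equivalent_sym DD1) DE'.
  - by rewrite (degree_equivalent DD1).
  exists D2; split=> //; first exact: equivalent_trans D12.
  exact: leq_ltn_trans hitD2.
have [D' [_ _]] := no_bound #|F|.+1.
by rewrite ltnNge subset_leq_card //; apply/subsetP => B; rewrite inE => /andP[].
Qed.
End EggCut.
End ChipFiring.

(** * The dodecahedron *)

Section Numbering.
Local Open Scope nat_scope.

Definition vert (n : nat) : dodecahedron :=
  if n < 10 then inl (inZp n) else inr (inZp (n - 10)).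

Definition unvert (v : dodecahedron) : nat :=
  match v with inl i => val i | inr i => 10 + val i end.

Definition neighbours : seq (seq nat) :=
  [:: [:: 1; 9; 10]; [:: 0; 2; 11]; [:: 1; 3; 12]; [:: 2; 4; 13];
      [:: 3; 5; 14]; [:: 4; 6; 15]; [:: 5; 7; 16]; [:: 6; 8; 17];
      [:: 7; 9; 18]; [:: 0; 8; 19]; [:: 0; 12; 18]; [:: 1; 13; 19];
      [:: 2; 10; 14]; [:: 3; 11; 15]; [:: 4; 12; 16]; [:: 5; 13; 17];
      [:: 6; 14; 18]; [:: 7; 15; 19]; [:: 8; 10; 16]; [:: 9; 11; 17]].

Definition adj (m n : nat) : bool := m \in nth [::] neighbours n.

Lemma unvert_lt v : unvert v < 20.
Proof.
case: v => -[i i10] /=; first exact: leq_trans i10 _.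
by rewrite -[20]/(10 + 10) ltn_add2l.
Qed.

Lemma unvertK : cancel unvert vert.
Proof.
case=> -[i i10]; rewrite /vert /unvert [val _]/=.
  by rewrite i10; congr inl; apply: val_inj; rewrite /= modn_small.
rewrite ltnNge leq_addr /= addKn; congr inr; apply: val_inj.
by rewrite /= modn_small.
Qed.

Lemma vertK : {in gtn 20, cancel vert unvert}.
Proof.
move=> n; rewrite inE /vert /= => n20; case: ltnP => n10 /=.
  by rewrite modn_small.
by rewrite modn_small ?subnKC // ltn_subLR.
Qed.

Lemma map_vert_uniq s : all (gtn 20) s -> uniq s -> uniq (map vert s).
Proof.
move=> /allP s20 uniq_s; rewrite map_inj_in_uniq // => m n /s20 m20 /s20 n20.
by move/(congr1 unvert); rewrite !vertK.
Qed.

Lemma mult_vert m n : m < 20 -> n < 20 -> mult (vert m) (vert n) = adj m n.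
Proof.
pose eq_adj m n := dodecahedron_adj (vert m) (vert n) == adj m n.
have: all (fun m => all (eq_adj m) (iota 0 20)) (iota 0 20) by vm_compute.
move=> /allP eq_mn m20 n20.
have /allP/(_ n) := eq_mn m (etrans (mem_iota 0 20 m) m20).
by move=> /(_ (etrans (mem_iota 0 20 n) n20))/eqP /= ->.
Qed.

Lemma mult_unvert u v : mult u v = adj (unvert u) (unvert v).
Proof. by rewrite -mult_vert ?unvert_lt // !unvertK. Qed.

Lemma perm_vert : perm_eq (index_enum dodecahedron) (map vert (iota 0 20)).
Proof.
apply: uniq_perm (index_enum_uniq _) (map_vert_uniq _ (iota_uniq 0 20)) _ => // v.
rewrite mem_index_enum; apply/esym/mapP; exists (unvert v).
  by rewrite mem_iota unvert_lt.
by rewrite unvertK.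
Qed.

Definition vert_set (s : seq nat) : {set dodecahedron} :=
  [set v | unvert v \in s].

Lemma card_vert_set s : all (gtn 20) s -> uniq s -> #|vert_set s| = size s.
Proof.
move=> s20 uniq_s.
have -> : vert_set s = [set v in map vert s].
  apply/setP => v; rewrite !inE; apply/idP/mapP => [vs|[n ns ->]].
    by exists (unvert v); rewrite ?unvertK.
  by rewrite vertK //; apply: (allP s20).
by rewrite cardsE (card_uniqP _) ?size_map // map_vert_uniq.
Qed.

(** A one-pass connectivity certificate: each vertex but the last has a neighbour further right, so
    the set grows from the end of the list. *)
Fixpoint linked (s : seq nat) : bool :=
  if s is n :: s' then ((s' == [::]) || has (adj n) s') && linked s' else true.

Lemma connected_vert_set s : linked s -> connected_set (vert_set s).
Proof.
set A := vert_set s; pose e := [rel x y | [&& x \in A, y \in A & 0 < mult x y]].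
have eE x y : e x y = [&& x \in A, y \in A & 0 < mult x y] by [].
have sym_e : connect_sym e.
  apply: sym_connect_sym => x y; apply: etrans (eE x y) (etrans _ (esym (eE y x))).
  by rewrite mult_sym andbCA.
suff conn t : {subset t <= s} -> linked t ->
    {in t &, forall m n, forall u v, unvert u = m -> unvert v = n -> connect e u v}.
  move=> linked_s; apply/forall_inP => u uA; apply/forall_inP => v vA.
  by rewrite !inE in uA vA; apply: (conn s) uA vA _ _ _ _.
elim: t => [|n t IHt] sub_s //= /andP[adj_n linked_t].
have {}sub_s : {subset t <= s} /\ n \in s.
  by split=> [m mt|]; apply: sub_s; rewrite inE ?eqxx ?mt ?orbT.
have {}IHt := IHt sub_s.1 linked_t.
have conn_n m u v : m \in t -> unvert u = n -> unvert v = m -> connect e u v.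
  move=> mt un vm; case/orP: adj_n => [/eqP t0|/hasP[k kt nk]].
    by rewrite t0 in mt.
  have k20 : k < 20.
    (* Beyond the table, [nth] defaults to an empty list of neighbours. *)
    by move: nk; rewrite /adj; case: (ltnP k 20) => // k20; rewrite nth_default.
  apply: (@connect_trans _ _ (vert k)); last by apply: (IHt k m); rewrite ?vertK.
  apply/connect1/(etrans (eE _ _)); rewrite !inE un vertK // sub_s.2 sub_s.1 //.
  by rewrite mult_unvert un vertK // nk.
move=> i j; rewrite !inE => /predU1P[->|it] /predU1P[->|jt] u v ui vj.
- by rewrite -(unvertK u) -(unvertK v) ui vj connect0.
- exact: conn_n vj.
- by rewrite sym_e; apply: conn_n ui.
- exact: IHt ui vj.
Qed.

(** * Searches for hitting sets and small cuts *)

Definition rotate (k n : nat) : nat :=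
  if n < 10 then (n + k) %% 10 else 10 + (n + k) %% 10.

(** Five connected six-vertex sets and their index shifts, enough that no five vertices meet them
    all. *)
Definition eggs : seq (seq nat) := Eval vm_compute in
  [seq map (rotate k) e | e <- [:: [:: 0; 1; 11; 19; 17; 7];
      [:: 0; 1; 2; 3; 13; 15]; [:: 18; 10; 0; 1; 11; 19];
      [:: 19; 11; 0; 1; 2; 12]; [:: 2; 0; 10; 12; 14; 4]], k <- iota 0 10].

(** If no egg avoids [s], [find] runs past the end, so the default [[::]] signals failure. *)
Definition egg_avoiding (s : seq nat) : seq nat :=
  nth [::] eggs (find (fun e => ~~ has (mem s) e) eggs).

Lemma egg_avoidingP s :
    egg_avoiding s != [::] ->
  egg_avoiding s \in eggs /\ {in egg_avoiding s, forall n, n \notin s}.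
Proof.
rewrite /egg_avoiding; set P := fun e => _.
have [has_P _|hasN_P] := boolP (has P eggs); last by rewrite hasNfind ?nth_default.
split; first by rewrite mem_nth -?has_find.
exact/hasPn/(nth_find _ has_P).
Qed.

(* A set meeting every egg meets [egg_avoiding s], so branch over which of its *)
(* vertices is added to [s], [n] times.                                        *)
Fixpoint hitting_number_gt (n : nat) (s : seq nat) : bool :=
  let e := egg_avoiding s in
  if e is [::] then false
  else if n is n'.+1 then all (fun v => hitting_number_gt n' (v :: s)) e
  else true.

Lemma hitting_number_gt5 : hitting_number_gt 5 [::].
Proof. by vm_compute. Qed.

(* The vertices of [t] remain to be placed on one of the two sides, with [c] *)
(* edges already cut. Nested [if]s, rather than [&&] and [||], stop           *)
(* call-by-value reduction from exploring pruned branches.                    *)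
Fixpoint cut_ge6 (t ins outs : seq nat) (c : nat) : bool :=
  if 5 < c then true
  else if size t + size ins <= 5 then true
  else if size t + size outs <= 5 then true
  else if t is v :: t' then
    if cut_ge6 t' (v :: ins) outs (c + count (adj v) outs)
    then cut_ge6 t' ins (v :: outs) (c + count (adj^~ v) ins) else false
  else false.

(* Breadth-first, so that edges get cut early and the search stays small. *)
Definition vertex_order : seq nat :=
  [:: 0; 1; 10; 9; 2; 11; 12; 18; 8; 19; 3; 13; 14; 16; 7; 17; 4; 15; 6; 5].

Lemma cut_ge6_vertex_order : cut_ge6 vertex_order [::] [::] 0.
Proof. by vm_compute. Qed.

(** * Soundness of the searches *)

Definition big_connected_sets : {set {set dodecahedron}} :=
  [set A | connected_set A & 5 < #|A|].

Lemma eggs_big_connected e : e \in eggs -> vert_set e \in big_connected_sets.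
Proof.
have: all (fun e => [&& all (gtn 20) e, uniq e, 5 < size e & linked e]) eggs.
  by vm_compute.
move=> /allP eggsP /eggsP/and4P[e20 uniq_e size_e linked_e].
by rewrite inE connected_vert_set // card_vert_set.
Qed.

(** [s] lists the elements of [S] found so far: an egg avoiding [s] either avoids [S] or yields a
    new element, at most [n] times. *)
Lemma hitting_number_gt_sound n s (S : {set dodecahedron}) :
    hitting_number_gt n s -> all (gtn 20) s -> uniq s -> vert_set s \subset S ->
    #|S| <= size s + n ->
  exists2 A, A \in big_connected_sets & [disjoint A & S].
Proof.
elim: n s => [|n IHn] s /=; set e := egg_avoiding s => hit_e s20 uniq_s sS leS;
  have /egg_avoidingP[egg_e e_s] : e != [::] by case: (e) hit_e.
  exists (vert_set e); first exact: eggs_big_connected.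
  have <- : vert_set s = S.
    by apply/eqP; rewrite eqEcard sS card_vert_set // -[size s]addn0.
  by apply/pred0P => v /=; rewrite !inE; apply/negP => /andP[/e_s/negP].
have {}hit_e : all (fun v => hitting_number_gt n (v :: s)) e by case: (e) hit_e.
have [disj|] := boolP [disjoint vert_set e & S].
  by exists (vert_set e); first exact: eggs_big_connected.
case/pred0Pn => v /andP[/= + vS]; rewrite inE => ve.
apply: (IHn (unvert v :: s)).
- exact: (allP hit_e _ ve).
- by rewrite /= unvert_lt.
- by rewrite /= e_s.
- apply/subsetP => w; rewrite !inE => /predU1P[|ws].
    by move/(can_inj unvertK) ->.
  by apply: (subsetP sS); rewrite inE.
- by rewrite /= addSnnS.
Qed.

Lemma big_connected_sets_hitting (S : {set dodecahedron}) :
  #|S| < 6 -> exists2 A, A \in big_connected_sets & [disjoint A & S].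
Proof.
move=> leS; apply: (hitting_number_gt_sound hitting_number_gt5) => //.
by apply/subsetP => v; rewrite inE.
Qed.

Lemma leq_sum_seq_set (T : finType) (r : seq T) (A : {set T}) (F : T -> nat) :
  uniq r -> {subset r <= A} -> \sum_(i <- r) F i <= \sum_(i in A) F i.
Proof.
move=> uniq_r rA; rewrite big_uniq // big_mkcond [leqRHS]big_mkcond.
by apply: leq_sum => i _; case: ifP => // /rA ->.
Qed.

Lemma leq_sum_adj_cut (U : {set dodecahedron}) s t :
    all (gtn 20) s -> all (gtn 20) t -> uniq s -> uniq t ->
    {in s, forall n, vert n \in U} -> {in t, forall n, vert n \notin U} ->
  \sum_(m <- s) \sum_(n <- t) adj m n <= cut U.
Proof.
move=> s20 t20 uniq_s uniq_t sU tU.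
have -> : \sum_(m <- s) \sum_(n <- t) adj m n =
    \sum_(u <- map vert s) \sum_(v <- map vert t) mult u v.
  rewrite big_map; apply: eq_big_seq => m /(allP s20) m20.
  by rewrite big_map; apply: eq_big_seq => n /(allP t20) n20; rewrite mult_vert.
apply: leq_trans (leq_sum_seq_set (A := U) _ (map_vert_uniq s20 uniq_s) _) _.
  by move=> _ /mapP[n ns ->]; apply: sU.
apply: leq_sum => u _; apply: leq_sum_seq_set; first exact: map_vert_uniq.
by move=> _ /mapP[n nt ->]; rewrite inE tU.
Qed.

(** Follow the branch that places each vertex as [U] does. Both sides of [U] have at least six
    vertices, so no size test can end it, and it must end with six cut edges counted. *)
Lemma cut_ge6_sound (U : {set dodecahedron}) t ins outs c :
    cut_ge6 t ins outs c -> perm_eq (t ++ ins ++ outs) (iota 0 20) ->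
    {in ins, forall n, vert n \in U} -> {in outs, forall n, vert n \notin U} ->
    c = \sum_(m <- ins) \sum_(n <- outs) adj m n ->
    5 < #|U| -> 5 < #|~: U| ->
  5 < cut U.
Proof.
have leq_card (A : {set dodecahedron}) r1 r2 :
    perm_eq (r1 ++ r2) (iota 0 20) -> {in r2, forall n, vert n \notin A} ->
    #|A| <= size r1.
  move=> perm_r r2A; rewrite -(size_map vert).
  apply: leq_trans (card_size _); apply: subset_leq_card; apply/subsetP => v vA.
  have : unvert v \in r1 ++ r2 by rewrite (perm_mem perm_r) mem_iota unvert_lt.
  rewrite mem_cat => /orP[vr1|/r2A]; last by rewrite unvertK vA.
  by apply/mapP; exists (unvert v); rewrite ?unvertK.
move=> + + + + + gt5U gt5CU.
have bounds r s1 s2 : perm_eq (r ++ s1 ++ s2) (iota 0 20) ->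
    {in s1, forall n, vert n \in U} -> {in s2, forall n, vert n \notin U} ->
  [/\ \sum_(m <- s1) \sum_(n <- s2) adj m n <= cut U,
      5 < size r + size s1 & 5 < size r + size s2].
  move=> perm_r s1U s2U; split.
  - have: all (gtn 20) (r ++ s1 ++ s2).
      by apply/allP => n; rewrite (perm_mem perm_r) mem_iota.
    have := iota_uniq 0 20; rewrite -(perm_uniq perm_r) !cat_uniq !all_cat.
    move=> /and3P[_ _ /and3P[uniq_s1 _ uniq_s2]] /and3P[_ s1_20 s2_20].
    exact: leq_sum_adj_cut.
  - rewrite -size_cat; apply: leq_trans gt5U _; apply: leq_card s2U.
    by rewrite -catA.
  - rewrite -size_cat; apply: leq_trans gt5CU _; apply: (leq_card _ _ s1).
      by rewrite -catA (perm_trans _ perm_r) // perm_cat2l perm_catC.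
    by move=> n /s1U; rewrite inE negbK.
elim: t ins outs c => [|v t IHt] ins outs c check perm_t insU outsU c_def;
  have [] := bounds _ _ _ perm_t insU outsU; rewrite -c_def => c_le gt_in gt_out;
  move: check => /=; case: (ltnP 5 c) => [c_gt5 _|_];
  rewrite ?(leq_trans c_gt5) // (leqNgt _ 5) gt_in (leqNgt _ 5) gt_out //=.
case: ifP => // check_in check_out.
have [vU|vU] := boolP (vert v \in U).
  apply: (IHt _ _ _ check_in) => //.
  - by apply: perm_trans perm_t; rewrite -[v :: ins]cat1s -catA perm_catCA.
  - by move=> n; rewrite inE => /predU1P[->|/insU].
  - rewrite big_cons addnC c_def; congr (_ + _).
    by elim: (outs) => [|w s IHs] /=;
      rewrite ?big_nil ?big_cons ?IHs.
apply: (IHt _ _ _ check_out) => //.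
- apply: perm_trans perm_t; rewrite -[v :: outs]cat1s catA perm_catCA.
  by rewrite -catA.
- by move=> n; rewrite inE => /predU1P[->|/outsU].
- under eq_bigr do rewrite big_cons.
  rewrite big_split addnC /= c_def; congr (_ + _).
  by elim: (ins) => [|w s IHs] /=;
    rewrite ?big_nil ?big_cons ?IHs.
Qed.

Lemma cut_ge6_big_connected (U A B : {set dodecahedron}) :
    A \in big_connected_sets -> B \in big_connected_sets ->
    A \subset U -> B \subset ~: U ->
  5 < cut U.
Proof.
rewrite !inE => /andP[_ gt5A] /andP[_ gt5B].
move=> /subset_leq_card leAU /subset_leq_card leBU.
apply: (cut_ge6_sound cut_ge6_vertex_order) => //.
- by rewrite big_nil.
- exact: leq_trans leAU.
- exact: leq_trans leBU.
Qed.
End Numbering.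

Lemma dodecahedron_gonality_ge6 (D : divisor dodecahedron) :
  positive_rank D -> 6%:Z <= degree D.
Proof.
apply: (@egg_cut_bound _ big_connected_sets) => //.
- by move=> A; rewrite inE => /andP[].
- by move=> A; rewrite inE -card_gt0 => /andP[_]; apply: leq_trans.
- exact: big_connected_sets_hitting.
- exact: cut_ge6_big_connected.
Qed.

(** * The upper bound *)

Definition six_chips : divisor dodecahedron :=
  [ffun v => if v == vert 0 then 6 else 0].

(* 7, 5, 4, 3, 2, 0 at distance 0, 1, 2, 3, 4, 5 from vertex 0: firing it moves *)
(* all six chips to the antipode.                                               *)
Definition potential (n : nat) : int :=
  Posz (nth 0 [:: 7; 5; 4; 3; 2; 0; 2; 3; 4; 5; 5; 4; 4; 3; 3; 2; 3; 3; 4; 4] n)%N.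

(** Only the end of the script is computed; [truncate_debt_free] then covers every level on the
    way. *)
Lemma potential_debt_free :
  debt_free (fire_script six_chips (potential \o unvert)).
Proof.
pose chips m := (if m == 0%N then 6 else 0) +
  foldr +%R 0 [seq (potential n - potential m) *+ adj n m | n <- iota 0 20].
have /allP chips_ge0 : all (fun m => 0 <= chips m) (iota 0 20) by vm_compute.
move=> v; have := chips_ge0 (unvert v); rewrite mem_iota => /(_ (unvert_lt v)).
congr (0 <= _); rewrite /chips !ffunE -(can_eq unvertK) vertK //.
congr (_ + _); rewrite foldrE big_map /spread (perm_big _ perm_vert) big_map.
apply: eq_big_seq => n; rewrite mem_iota => n20.
by rewrite mult_unvert /= !vertK.
Qed.

(** A neighbour one step closer to vertex 0 has higher potential. *)
Lemma potential_ascent n :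
  (0 < n < 20)%N -> exists2 m, (m < 20)%N & adj m n /\ potential n < potential m.
Proof.
pose ascent n m := adj m n && (potential n < potential m).
have: all (fun n => has (ascent n) (iota 0 20)) (iota 1 19) by vm_compute.
move=> /allP asc n20; have /hasP[m] := asc n (etrans (mem_iota 1 19 n) n20).
by rewrite mem_iota => m20 /andP[]; exists m.
Qed.

Lemma six_chips_positive_rank : positive_rank six_chips.
Proof.
have chips_ge0 : debt_free six_chips by move=> v; rewrite ffunE; case: eqP.
apply/positive_rankE => q; pose f := potential \o unvert.
(* At this level a neighbour of [q] closer to vertex 0 has fired more often than [q], which thus
   holds a chip; for [q] equal to vertex 0, nothing has fired yet. *)
exists (truncate six_chips f (f q)); split.
- exact: equivalent_truncate.
- exact: truncate_debt_free potential_debt_free.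
have [->|nq0] := eqVneq q (vert 0).
  by apply: lt_le_trans (truncate_ge _ (lexx _)); rewrite ffunE eqxx.
have [|m m20 [mq asc]] := @potential_ascent (unvert q).
  rewrite unvert_lt lt0n andbT; apply: contraNneq nq0 => <-.
  by rewrite unvertK.
apply: le_lt_trans (chips_ge0 q) (@truncate_gt _ _ _ _ (vert m) _ (lexx _) _ _).
  by rewrite /f /= vertK.
by rewrite mult_unvert vertK // mq.
Qed.

Theorem mainTheorem1 : is_gonality dodecahedron 6%Z.
Proof.
split=> [|M [D [<-]]]; last exact: dodecahedron_gonality_ge6.
exists six_chips; split; last exact: six_chips_positive_rank.
rewrite /degree; under eq_bigr do rewrite ffunE.
by rewrite -big_mkcond big_pred1_eq.
Qed.
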